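(* Let $m\ge1$ and let $\phi:[0,1]^m\to[0,1]^m$ be a Lipschitz continuous map with partial Lipschitz constants $L_\phi^{(l)}$, $l=1,\dots,m$, whose partial derivatives $\partial_l\phi:[0,1]^m\to\mathbb{R}^m$ with respect to the $l$th variable are also Lipschitz continuous, with partial Lipschitz constant $L^{(l)}_{\partial_l\phi}$ (with respect to the $l$th variable), for all $l$. Let $\mathcal{K}f=f\circ\phi$ be the associated Koopman operator. Then, for any $f\in C^1([0,1]^m)$ and any $\mathbf{n}=(n_1,\dots,n_m)$ with positive integer entries, $$\|\mathcal{B}_\mathbf{n}\mathcal{K}f-\mathcal{K}f\|_\infty\leq\sum_{l=1}^m\frac{1}{\sqrt{n_l}}\left(L^{(l)}_{\phi}\,\Omega_{\nabla f}\left(\frac{L^{(l)}_{\phi}}{2\sqrt{n_l}}\right)\bigg|_{\phi([0,1]^m)}+\sup_{\mathbf{x}\in\phi([0,1]^m)}\|\nabla f(\mathbf{x})\|\,\frac{L^{(l)}_{\partial_l\phi}}{2\sqrt{n_l}}\right).$$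
   Context: $C([0,1]^m)$ (resp. $C^1([0,1]^m)$) is the space of continuous (resp. continuously differentiable) complex-valued functions on $[0,1]^m$, with $\|f\|_\infty=\sup_{\mathbf{x}\in[0,1]^m}|f(\mathbf{x})|$; $\|\cdot\|$ is the Euclidean norm on vectors. The Bernstein operator $\mathcal{B}_\mathbf{n}:C([0,1]^m)\to C([0,1]^m)$ is $$(\mathcal{B}_\mathbf{n}f)(\mathbf{x})=\mathcal{B}_\mathbf{n}(f;\mathbf{x})=\sum_{k_1=0}^{n_1}\cdots\sum_{k_m=0}^{n_m} f\left(\tfrac{k_1}{n_1},\dots,\tfrac{k_m}{n_m}\right)\prod_{l=1}^m b_{n_l,k_l}(x_l),\qquad b_{n,k}(x)=\binom{n}{k}x^k(1-x)^{n-k}.$$ A partial Lipschitz constant $L_g^{(l)}\ge0$ of a map $g:[0,1]^m\to\mathbb{R}^m$ is a real number such that $\|g(\mathbf{x})-g(\mathbf{y})\|\le L_g^{(l)}|x_l-y_l|$ for all $\mathbf{x},\mathbf{y}\in[0,1]^m$ that differ only in their $l$th coordinate. For a vector-valued function $g$ on $[0,1]^m$, $A\subseteq[0,1]^m$ and $\delta\ge0$, the modulus of continuity evaluated over $A$ is $\Omega_g(\delta)|_A=\sup\{\|g(\mathbf{x})-g(\mathbf{y})\|:\mathbf{x},\mathbf{y}\in A,\ \|\mathbf{x}-\mathbf{y}\|\le\delta\}$. *)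

(* Defs.v *)
From HB Require Import structures.
From mathcomp Require Import all_boot all_order all_algebra.
From mathcomp Require Import complex.
From mathcomp Require Import all_classical all_reals all_analysis.

Set Implicit Arguments.
Unset Strict Implicit.
Unset Printing Implicit Defensive.

Import Order.TTheory GRing.Theory Num.Theory.
Import numFieldNormedType.Exports.

Local Open Scope classical_set_scope.
Local Open Scope ring_scope.

(* [Rcomplex R] is R[i] seen as a real vector space, normed by the modulus
   (a real number).  We equip it with the topology of that norm, so that complex
   values are covered by the theory of normed modules over R. *)
HB.instance Definition _ (R : realType) :=
  PseudoMetric.copy (Rcomplex R) (pseudoMetric_normed (Rcomplex R)).

HB.instance Definition _ (R : realType) := isPointed.Build (Rcomplex R) 0.

HB.instance Definition _ (R : realType) :=
  NormedZmod_PseudoMetric_eq.Build R (Rcomplex R) erefl.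

Lemma Rcomplex_normrZ (R : realType) (a : R) (z : Rcomplex R) :
  `|a *: z| = `|a| * `|z|.
Proof.
case: z => x y; rewrite -[LHS]/(Num.sqrt ((a * x) ^+ 2 + (a * y) ^+ 2)).
by rewrite -[in RHS]sqrtr_sqr -sqrtrM ?sqr_ge0// mulrDr -!exprMn.
Qed.

HB.instance Definition _ (R : realType) :=
  PseudoMetricNormedZmod_Lmodule_isNormedModule.Build R (Rcomplex R)
    (@Rcomplex_normrZ R).

Definition cube (R : realType) (m : nat) : set 'rV[R]_m :=
  [set x | forall l, 0 <= x 0 l <= 1].
Arguments cube {R m}.

(* The library norm on row vectors is the maximum norm, hence this definition;
   the entries may be real ([V := R]) or complex ([V := Rcomplex R]). *)
Definition enorm (R : realType) (V : normedZmodType R) (k : nat)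
  (v : 'rV[V]_k) : R := Num.sqrt (\sum_(i < k) `|v 0 i| ^+ 2).

Definition supnorm (R : realType) (V : normedZmodType R) (m : nat)
  (f : 'rV[R]_m -> V) : R := sup [set `|f x| | x in cube].

(* Partial derivatives of functions on the cube: the increments are restricted
   to those that stay in the cube, so that the derivatives are one-sided on the
   corresponding faces.  Values outside the cube are irrelevant. *)
Section partial_derivatives.
Variables (R : realType) (m : nat) (V : normedModType R).
Implicit Types (g : 'rV[R]_m -> V) (l : 'I_m) (x : 'rV[R]_m).

Definition pquotient g l x : R -> V :=
  fun h => h^-1 *: (g (x + h *: delta_mx 0 l) - g x).

Definition pincrement l x : set_system R :=
  within [set h | cube (x + h *: delta_mx 0 l)] 0^'.

Definition pderivable g l x : Prop :=
  cvg (pquotient g l x @ pincrement l x).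

Definition pderive g l x : V := lim (pquotient g l x @ pincrement l x).

Definition C1_cube g : Prop :=
  {within cube, continuous g} /\
  forall l, (forall x, cube x -> pderivable g l x) /\
    {within cube, continuous (pderive g l)}.

Definition gradient g x : 'rV[V]_m := \row_l pderive g l x.

End partial_derivatives.

Definition lipschitz_cube (R : realType) (m k : nat)
    (g : 'rV[R]_m -> 'rV[R]_k) : Prop :=
  exists K : R, forall x y, cube x -> cube y ->
    enorm (g x - g y) <= K * enorm (x - y).

Definition partial_lipschitz (R : realType) (m k : nat)
    (g : 'rV[R]_m -> 'rV[R]_k) (l : 'I_m) (L : R) : Prop :=
  0 <= L /\
  forall x y, cube x -> cube y -> (forall j, j != l -> x 0 j = y 0 j) ->
    enorm (g x - g y) <= L * `|x 0 l - y 0 l|.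

Definition modulus_on (R : realType) (V : normedZmodType R) (m k : nat)
    (A : set 'rV[R]_m) (g : 'rV[R]_m -> 'rV[V]_k) (delta : R) : R :=
  sup [set r | exists x y, [/\ A x, A y, enorm (x - y) <= delta
                             & r = enorm (g x - g y)]].

Definition bernstein_basis (R : realType) (n k : nat) (x : R) : R :=
  'C(n, k)%:R * x ^+ k * (1 - x) ^+ (n - k).

Definition bernstein (R : realType) (V : normedModType R) (m : nat)
    (n : 'I_m -> nat) (f : 'rV[R]_m -> V) : 'rV[R]_m -> V :=
  fun x => \sum_(k : {dffun forall l : 'I_m, 'I_(n l).+1})
    (\prod_l bernstein_basis (n l) (k l) (x 0 l)) *:
      f (\row_l ((k l)%:R / (n l)%:R)).

Definition koopman (R : realType) (V : Type) (m : nat)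
    (phi : 'rV[R]_m -> 'rV[R]_m) (f : 'rV[R]_m -> V) : 'rV[R]_m -> V :=
  f \o phi.

(* Main.v *)
From HB Require Import structures.
Require Import Defs.
From mathcomp Require Import all_boot all_order all_algebra.
From mathcomp Require Import complex.
From mathcomp Require Import all_classical all_reals all_analysis.
From mathcomp Require Import ring lra.

Import Order.TTheory GRing.Theory Num.Theory.
Import numFieldNormedType.Exports.

Local Open Scope classical_set_scope.
Local Open Scope ring_scope.

Set Implicit Arguments.
Unset Strict Implicit.
Unset Printing Implicit Defensive.

(* For every point x choose a real-linear functional lam of norm at most one on the
   values with lam z = |z|, where z is the error at x; it then suffices to treat the real
   function g = lam o f o phi.  By the chain rule its l-th partial derivative is
   sum_j d_l phi_j * lam (d_j f o phi), and by Cauchy-Schwarz it varies by at most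
     W_l = L_phi Omega(L_phi delta_l) + sup |grad f| L_dphi delta_l
   over steps of length delta_l = 1 / (2 sqrt n_l) in direction l.  In one variable,
   the mean value theorem gives
     |g t - g x - g' x (t - x)| <= |t - x| (1 + |t - x| / delta) W,
   whose Bernstein average is at most 2 delta W because the Bernstein weights have
   mean x and variance at most delta^2.  In several variables the coordinates are
   replaced one at a time, each step being a one-dimensional Bernstein error averaged
   over the other coordinates.
   The chain rule has to hold where phi touches the boundary of the cube: there it
   is obtained from the mean value theorem along coordinate segments, which stay in
   the cube, and from the continuity of the partial derivatives. *)

(** Distributivity for index types that depend on [i]: the identity for [fprod] is transported along
    its bijection with dependent finite functions. *)
Lemma sum_dffun_prod (R : comPzSemiRingType) (I : finType) (T : I -> finType)
    (F : forall i, T i -> R) :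
  \sum_(k : {dffun forall i, T i}) \prod_i F i (k i) =
  \prod_i \sum_(j : T i) F i j.
Proof.
have E := @big_tag R 0 +%R I T F.
under [RHS]eq_bigr do rewrite E.
rewrite bigA_distr_big_dep.
have := @big_fprod R 0 1 *%R +%R I T (fun i => [ffun j => F i j]).
rewrite (reindex_onto (@dffun_of_fprod I T) (@fprod_of_dffun I T)) /=; last first.
  by move=> k _; apply: fprod_of_dffunK.
move=> H; transitivity (\sum_t \prod_(i in I) [ffun j => F i j] ((t : fprod T) i)).
  apply: eq_big => [t|t _]; first by rewrite dffun_of_fprodK eqxx.
  by apply: eq_bigr => i _; rewrite !ffunE.
rewrite H; apply: eq_bigr => g _; apply: eq_bigr => i _.
by case: (g i) => j t; rewrite /untag /=; case: eqP => // e; rewrite ffunE.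
Qed.

(** * Moments of the one-variable Bernstein weights and the resulting error bound *)

Section bernstein_1d.
Variable R : realType.
Implicit Types (x : R) (n : nat) (h : nat -> R).

Lemma bernstein_basis_ge0 n k x : 0 <= x <= 1 -> 0 <= bernstein_basis n k x.
Proof.
move=> /andP[x0 x1]; rewrite /bernstein_basis !mulr_ge0// ?exprn_ge0//.
by rewrite subr_ge0.
Qed.

(** Pascal's rule, read as conditioning on one of [n + 1] Bernoulli trials: failure keeps [i],
    success shifts it to [i.+1]. *)
Lemma bernstein_sumS n x h :
  \sum_(i < n.+2) bernstein_basis n.+1 i x * h i =
  (1 - x) * (\sum_(i < n.+1) bernstein_basis n i x * h i) +
  x * (\sum_(i < n.+1) bernstein_basis n i x * h i.+1).
Proof.
rewrite big_ord_recl.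
rewrite (eq_bigr (fun i : 'I_n.+1 => (1 - x) * (bernstein_basis n i.+1 x * h i.+1)
   + x * (bernstein_basis n i x * h i.+1))); last first.
  move=> i _; rewrite /bernstein_basis lift0 binS natrD subSS.
  (* For [i < n] the exponent [n - i] is a successor; for [i = n] it is not, but the term with
     [i.+1] vanishes since ['C(n, n.+1)] is zero. *)
  have [lt_in|] := ltnP i n.
    have -> : (n - i)%N = (n - i.+1).+1 by rewrite -subSn.
    by rewrite !exprS; ring.
  move=> le_ni; rewrite bin_small ?ltnS//.
  by rewrite exprS; ring.
rewrite big_split /= -!mulr_sumr addrA; congr (_ + _).
rewrite [in LHS]big_ord_recr [in RHS]big_ord_recl /= {3}/bernstein_basis.
rewrite bin_small// !mul0r addr0 mulrDr; congr (_ + _).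
by rewrite /bernstein_basis !bin0 !subn0 !expr0 exprS; ring.
Qed.

Lemma bernstein_moment0 n x : \sum_(i < n.+1) bernstein_basis n i x = 1.
Proof.
rewrite -[RHS](expr1n _ n) -[X in _ = X ^+ _](subrK x) exprDn.
by apply: eq_bigr => i _; rewrite /bernstein_basis -mulrA mulr_natl [x ^+ _ * _]mulrC.
Qed.

(** The centre [c] is arbitrary because the shift to [i.+1] in the recursion turns [c] into
    [c - 1]. *)
Lemma bernstein_moment1 n x (c : R) :
  \sum_(i < n.+1) bernstein_basis n i x * (i%:R - c) = n%:R * x - c.
Proof.
elim: n c => [|n IH] c.
  by rewrite big_ord1 /bernstein_basis /= bin0 subnn !expr0; ring.
rewrite (bernstein_sumS _ _ (fun i => i%:R - c)) IH.
rewrite (eq_bigr (fun i : 'I_n.+1 => bernstein_basis n i x * (i%:R - (c - 1)))).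
  by rewrite IH -natr1; ring.
by move=> i _; rewrite -natr1; ring.
Qed.

Lemma bernstein_moment2 n x (c : R) :
  \sum_(i < n.+1) bernstein_basis n i x * (i%:R - c) ^+ 2 =
  n%:R * x * (1 - x) + (n%:R * x - c) ^+ 2.
Proof.
elim: n c => [|n IH] c.
  by rewrite big_ord1 /bernstein_basis /= bin0 subnn !expr0; ring.
rewrite (bernstein_sumS _ _ (fun i => (i%:R - c) ^+ 2)) IH.
rewrite (eq_bigr (fun i : 'I_n.+1 =>
    bernstein_basis n i x * (i%:R - (c - 1)) ^+ 2)).
  by rewrite IH -natr1; ring.
by move=> i _; rewrite -natr1; ring.
Qed.

Lemma bernstein_variance n x : (0 < n)%N ->
  \sum_(i < n.+1) bernstein_basis n i x * (i%:R / n%:R - x) ^+ 2 =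
  x * (1 - x) / n%:R.
Proof.
move=> n_gt0; have n0 : n%:R != 0 :> R by rewrite pnatr_eq0 -lt0n.
rewrite (eq_bigr (fun i : 'I_n.+1 =>
  n%:R ^- 2 * (bernstein_basis n i x * (i%:R - n%:R * x) ^+ 2))).
  by rewrite -mulr_sumr bernstein_moment2; field.
by move=> i _; field.
Qed.

Lemma bernstein_mean n x : (0 < n)%N ->
  \sum_(i < n.+1) bernstein_basis n i x * (i%:R / n%:R - x) = 0.
Proof.
move=> n_gt0; have n0 : n%:R != 0 :> R by rewrite pnatr_eq0 -lt0n.
rewrite (eq_bigr (fun i : 'I_n.+1 =>
  n%:R^-1 * (bernstein_basis n i x * (i%:R - n%:R * x)))).
  by rewrite -mulr_sumr bernstein_moment1 subrr mulr0.
by move=> i _; field.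
Qed.

(* [|t - x| <= delta / 2 + (t - x)^2 / (2 delta)] (AM-GM) bounds the remainder by
   a quadratic polynomial in [t - x], so that the variance alone suffices. *)
Lemma bernstein_error_1d n x (g : R -> R) (a W : R) :
  (0 < n)%N -> 0 <= x <= 1 -> 0 <= W ->
  let delta := (2 * Num.sqrt n%:R)^-1 in
  (forall t, 0 <= t <= 1 ->
     `|g t - g x - a * (t - x)| <= `|t - x| * ((1 + `|t - x| / delta) * W)) ->
  `|\sum_(i < n.+1) bernstein_basis n i x * (g (i%:R / n%:R) - g x)| <=
  (Num.sqrt n%:R)^-1 * W.
Proof.
move=> n_gt0 x01 W0 delta gP.
have n0 : 0 < n%:R :> R by rewrite ltr0n.
have s0 : 0 < Num.sqrt n%:R :> R by rewrite sqrtr_gt0.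
have d0 : 0 < delta by rewrite invr_gt0 mulr_gt0.
(* The affine part [a * (t - x)] averages to zero, so only the remainder has to be estimated. *)
rewrite (eq_bigr (fun i : 'I_n.+1 => a * (bernstein_basis n i x * (i%:R / n%:R - x))
  + bernstein_basis n i x * (g (i%:R / n%:R) - g x -
                             a * (i%:R / n%:R - x)))); last first.
  by move=> i _; ring.
rewrite big_split /= -mulr_sumr bernstein_mean// mulr0 add0r.
apply: le_trans (ler_norm_sum _ _ _) _.
(* The coefficient [3 / (2 * delta)] adds the [1 / delta] of the hypothesis on [g] to the
   [1 / (2 * delta)] of the AM-GM bound. *)
apply: (@le_trans _ _ (\sum_(i < n.+1) (delta / 2 * W * bernstein_basis n i x +
   (3 / (2 * delta) * W) * (bernstein_basis n i x * (i%:R / n%:R - x) ^+ 2)))).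
  apply: ler_sum => i _; rewrite normrM ger0_norm ?bernstein_basis_ge0//.
  have -> : delta / 2 * W * bernstein_basis n i x +
   (3 / (2 * delta) * W) * (bernstein_basis n i x * (i%:R / n%:R - x) ^+ 2) =
   bernstein_basis n i x *
     ((delta / 2 + 3 / (2 * delta) * (i%:R / n%:R - x) ^+ 2) * W)
   by ring.
  apply: ler_wpM2l; first exact: bernstein_basis_ge0.
  apply: le_trans (gP _ _) _.
    by rewrite divr_ge0//= ler_pdivrMr// mul1r ler_nat -ltnS.
  rewrite mulrA ler_wpM2r// -[(_ - x) ^+ 2]real_normK ?num_real//.
  set u := `|_ - x|.
  have : 0 <= (delta - u) ^+ 2 / (2 * delta).
    by rewrite divr_ge0 ?sqr_ge0// mulr_ge0// ltW.
  have -> : (delta - u) ^+ 2 / (2 * delta) =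
     delta / 2 + 3 / (2 * delta) * u ^+ 2 - u * (1 + u / delta).
    by field; rewrite gt_eqF.
  by rewrite subr_ge0.
rewrite big_split /= -!mulr_sumr bernstein_moment0 bernstein_variance//.
rewrite mulr1 [_ * W * (_ / _)]mulrAC -mulrDl ler_wpM2r//.
(* Both sides equal [2 * delta]; the factor [delta ^+ 2] will dominate the variance because
   [x * (1 - x) <= 1 / 4]. *)
have -> : (Num.sqrt n%:R)^-1 = delta / 2 + 3 / (2 * delta) * delta ^+ 2.
  by rewrite /delta; field; rewrite gt_eqF.
rewrite lerD2l ler_wpM2l ?divr_ge0 ?mulr_ge0 ?(ltW d0)//.
have -> : delta ^+ 2 = 1 / 4 / n%:R.
  by rewrite /delta exprVn exprMn sqr_sqrtr ?ltW//; field; rewrite gt_eqF.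
rewrite ler_pM2r ?invr_gt0//; have := sqr_ge0 (x - 1 / 2); lra.
Qed.

(* Chaining through about [|a - b| / delta] intermediate points. *)
Lemma modulus_chain (D : R -> R) (delta W : R) : 0 < delta -> 0 <= W ->
  (forall a b, 0 <= a <= 1 -> 0 <= b <= 1 -> `|a - b| <= delta ->
     `|D a - D b| <= W) ->
  forall a b, 0 <= a <= 1 -> 0 <= b <= 1 ->
    `|D a - D b| <= (1 + `|a - b| / delta) * W.
Proof.
move=> d0 W0 DW.
have chain N : forall a b, 0 <= a <= 1 -> 0 <= b <= 1 ->
    `|a - b| <= N.+1%:R * delta -> `|D a - D b| <= N.+1%:R * W.
  elim: N => [|N IH] a b a01 b01 ab; first by rewrite mul1r DW// -[delta]mul1r.
  have N0 : 0 < N.+2%:R :> R by rewrite ltr0n.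
  have NS : N.+2%:R = N.+1%:R + 1 :> R by rewrite natr1.
  have N1 : 0 <= N.+1%:R :> R by rewrite ler0n.
  (* [c] lies at the fraction [1 / N.+2] of the way from [a] to [b]: one step leads from [a] to [c],
     and the induction hypothesis covers the rest. *)
  pose c := (N.+1%:R * a + b) / N.+2%:R.
  have c01 : 0 <= c <= 1.
    by rewrite /c divr_ge0 ?ler_pdivrMr//= ?NS; nra.
  have NB : N.+1%:R = N.+2%:R - 1 :> R by rewrite NS addrK.
  have p0 : N.+2%:R != 0 :> R by rewrite gt_eqF.
  have Eac : a - c = (a - b) / N.+2%:R by rewrite /c NB; field.
  have Ecb : c - b = (a - b) * (N.+1%:R / N.+2%:R) by rewrite /c NB; field.
  rewrite -[D a](subrK (D c)) -addrA NS mulrDl mul1r addrC.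
  apply: le_trans (ler_normD _ _) _; rewrite lerD//.
    apply: IH => //; rewrite Ecb normrM [`|_ / _|]ger0_norm ?divr_ge0 ?ler0n//.
    rewrite mulrCA ler_pM2l ?ltr0n// ler_pdivrMr//.
    by rewrite mulrC.
  apply: DW => //; rewrite Eac normrM [`|_^-1|]ger0_norm ?invr_ge0 ?ler0n//.
  by rewrite ler_pdivrMr// mulrC.
move=> a b a01 b01.
have q0 : 0 <= `|a - b| / delta by rewrite divr_ge0// ltW.
apply: le_trans (chain (Num.truncn (`|a - b| / delta)) _ _ a01 b01 _) _.
  by rewrite -ler_pdivrMr// ltW// truncnS_gt.
by rewrite ler_wpM2r// -natr1 addrC lerD2l truncn_le.
Qed.

End bernstein_1d.

(** Resampling one coordinate does not change an expectation: exchanging the [l]-th value of [k]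
    with an independent draw [j] is an involution on pairs that preserves the product weight. *)
Lemma sum_dffun_resample (R : comPzSemiRingType) (I : finType) (T : I -> finType)
    (w : forall i, T i -> R) (l : I) (H : {dffun forall i, T i} -> R) :
  \sum_(j : T l) w l j = 1 ->
  \sum_(k : {dffun forall i, T i}) (\prod_i w i (k i)) * H k =
  \sum_(k : {dffun forall i, T i}) (\prod_i w i (k i)) *
    \sum_(j : T l) w l j * H [ffun i => dfwith k l j i].
Proof.
move=> w1.
pose S := ({dffun forall i, T i} * T l)%type.
pose swap (u : S) : S := ([ffun i => dfwith u.1 l u.2 i], u.1 l).
have swapK : involutive swap.
  move=> [k j]; rewrite /swap /= ffunE dfwithin; congr (_, _).
  apply/ffunP => i; rewrite ffunE; case: dfwithP => // i' li'.
  by rewrite ffunE dfwithout.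
have prodE (k : {dffun forall i, T i}) :
    \prod_i w i (k i) = w l (k l) * \prod_(i | i != l) w i (k i).
  by rewrite (bigD1 l).
transitivity (\sum_(u : S) (\prod_i w i (u.1 i)) * (w l u.2 * H u.1)).
  rewrite -(pair_bigA _ (fun (k : {dffun forall i, T i}) j =>
    (\prod_i w i (k i)) * (w l j * H k))) /=.
  by apply: eq_bigr => k _; rewrite -mulr_sumr -mulr_suml w1 mul1r.
rewrite (reindex_inj (inv_inj swapK)) /=.
under [RHS]eq_bigr do rewrite mulr_sumr.
rewrite pair_bigA /=; apply: eq_bigr => -[k j] _ /=.
rewrite !prodE ffunE dfwithin mulrACA mulrA [RHS]mulrA; congr (_ * _).
rewrite [RHS]mulrC mulrA; congr (_ * _).
by apply: eq_bigr => i il; rewrite ffunE dfwithout// eq_sym.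
Qed.

(** * Points of the cube modified coordinate by coordinate *)

Section hybrid_points.
Variables (R : realType) (m : nat).
Implicit Types (x y z : 'rV[R]_m) (l : 'I_m) (t : R) (p : nat).

Definition set_coord x l t : 'rV[R]_m := \row_j (if j == l then t else x 0 j).

(** [p] is a natural number rather than an element of ['I_m], so that the path includes both ends,
    [x] at [p = 0] and [y] at [p = m]. *)
Definition hybrid x y p : 'rV[R]_m :=
  \row_j (if (j < p)%N then y 0 j else x 0 j).

Lemma set_coord_at x l t : set_coord x l t 0 l = t.
Proof. by rewrite mxE eqxx. Qed.

Lemma set_coord_id x l : set_coord x l (x 0 l) = x.
Proof. by apply/rowP => j; rewrite mxE; case: eqP => // ->. Qed.

Lemma set_coordD x l s h :
  set_coord x l s + h *: delta_mx 0 l = set_coord x l (s + h).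
Proof.
apply/rowP => j; rewrite !mxE eqxx /=.
by case: eqP => _; rewrite ?mulr1 ?mulr0 ?addr0.
Qed.

Lemma addr_delta x l h : x + h *: delta_mx 0 l = set_coord x l (x 0 l + h).
Proof. by rewrite -{1}[x](set_coord_id x l) set_coordD. Qed.

Lemma cube_set_coord x l t : cube x -> 0 <= t <= 1 -> cube (set_coord x l t).
Proof. by move=> cx t01 j; rewrite mxE; case: eqP. Qed.

Lemma cube_hybrid x y p : cube x -> cube y -> cube (hybrid x y p).
Proof. by move=> cx cy j; rewrite mxE; case: ifP. Qed.

Lemma hybrid_at x y l : hybrid x y l 0 l = x 0 l.
Proof. by rewrite mxE ltnn. Qed.

Lemma hybridS x y l : hybrid x y l.+1 = set_coord (hybrid x y l) l (y 0 l).
Proof.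
apply/rowP => j; rewrite !mxE ltnS leq_eqVlt.
have -> : (j == l :> nat) = (j == l) by [].
by case: eqP => // ->; rewrite ltnn.
Qed.

Lemma hybrid_telescope (V : zmodType) (g : 'rV[R]_m -> V) x y :
  g y - g x = \sum_(l < m) (g (set_coord (hybrid x y l) l (y 0 l)) -
                            g (hybrid x y l)).
Proof.
under eq_bigr do rewrite -hybridS.
rewrite -(big_mkord xpredT (fun p => g (hybrid x y p.+1) - g (hybrid x y p))).
rewrite telescope_sumr//; congr (g _ - g _); apply/rowP => j; rewrite mxE//.
by rewrite ltn_ord.
Qed.

End hybrid_points.

(** * Reduction of the multivariate Bernstein error to one variable *)

Definition bernstein_node (R : realType) (m : nat) (n : 'I_m -> nat)
    (k : {dffun forall l : 'I_m, 'I_(n l).+1}) : 'rV[R]_m :=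
  \row_l ((k l)%:R / (n l)%:R).

Lemma cube_node (R : realType) (m : nat) (n : 'I_m -> nat)
    (k : {dffun forall l : 'I_m, 'I_(n l).+1}) :
  (forall l, (0 < n l)%N) -> cube (bernstein_node R k).
Proof.
move=> n_gt0 l; rewrite mxE divr_ge0//= ler_pdivrMr ?ltr0n//.
by rewrite mul1r ler_nat -ltnS.
Qed.

Lemma bernstein_weights_sum (R : realType) (m : nat) (n : 'I_m -> nat)
    (x : 'rV[R]_m) :
  \sum_(k : {dffun forall l : 'I_m, 'I_(n l).+1})
    \prod_l bernstein_basis (n l) (k l) (x 0 l) = 1.
Proof.
pose w l (i : 'I_(n l).+1) := bernstein_basis (n l) i (x 0 l).
rewrite (sum_dffun_prod w); under eq_bigr do rewrite bernstein_moment0.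
by rewrite big1_eq.
Qed.

(* Resampling the [l]-th node reduces the [l]-th telescoping increment to the
   one-dimensional operator in that variable. *)
Lemma bernstein_error_coord (R : realType) (m : nat) (n : 'I_m -> nat)
    (g : 'rV[R]_m -> R) (E : 'I_m -> R) (x : 'rV[R]_m) :
  (forall l, (0 < n l)%N) -> cube x ->
  (forall l y, cube y ->
     `|\sum_(i < (n l).+1) bernstein_basis (n l) i (y 0 l) *
         (g (set_coord y l (i%:R / (n l)%:R)) - g y)| <= E l) ->
  `|\sum_(k : {dffun forall l : 'I_m, 'I_(n l).+1})
      (\prod_l bernstein_basis (n l) (k l) (x 0 l)) *
        (g (bernstein_node R k) - g x)| <= \sum_l E l.
Proof.
move=> n_gt0 cx gE.
pose w l (i : 'I_(n l).+1) := bernstein_basis (n l) i (x 0 l).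
have w1 l : \sum_(i : 'I_(n l).+1) w l i = 1 by exact: bernstein_moment0.
have w0 (k : {dffun forall l : 'I_m, 'I_(n l).+1}) : 0 <= \prod_l w l (k l).
  by apply: prodr_ge0 => l _; apply: bernstein_basis_ge0.
under eq_bigr do rewrite (hybrid_telescope g) mulr_sumr.
rewrite exchange_big /=; apply: le_trans (ler_norm_sum _ _ _) _.
apply: ler_sum => l _.
rewrite (@sum_dffun_resample _ _ _ w l)//.
apply: le_trans (ler_norm_sum _ _ _) _.
apply: (@le_trans _ _ (\sum_(k : {dffun forall l : 'I_m, 'I_(n l).+1})
   (\prod_l w l (k l)) * E l)); last first.
  by rewrite -mulr_suml bernstein_weights_sum mul1r.
apply: ler_sum => k _; rewrite normrM ger0_norm//; apply: ler_wpM2l => //.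
pose z := hybrid x (bernstein_node R k) l.
have cz : cube z by apply: cube_hybrid => //; apply: cube_node.
apply: le_trans (gE l z cz); rewrite hybrid_at le_eqVlt; apply/orP; left.
apply/eqP; congr `| _ |; apply: eq_bigr => i _.
(* The hybrid point at stage [l] uses the node only in coordinates below [l], so resampling
   coordinate [l] leaves it fixed. *)
have -> : hybrid x (bernstein_node R [ffun j => dfwith k l i j]) l = z.
  apply/rowP => j; rewrite !mxE ffunE; case: ifP => // jl.
  by rewrite dfwithout//; apply: contraTneq jl => <-; rewrite ltnn.
by rewrite mxE ffunE dfwithin.
Qed.

(** * Limits and differential calculus on the closed cube *)

Lemma cvg_sumr (R : realType) (I : finType) (S : Type) (F : set_system S)
    (FF : Filter F) (u : I -> S -> R) (a : I -> R) :
  (forall i, u i @ F --> a i) -> \sum_i u i s @[s --> F] --> \sum_i a i.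
Proof.
move=> ua.
have add_cont : continuous (fun r : R * R => r.1 + r.2).
  by move=> r; apply: add_continuous.
by apply: (cvg_big add_cont) => i _; apply: ua.
Qed.

Section cube_calculus.
Variables (R : realType) (m : nat).
Implicit Types (x y z p q : 'rV[R]_m) (l j : 'I_m).

Lemma cvg_to_within (S : Type) (T : topologicalType) (F : set_system S)
    (FF : Filter F) (A : set T) (u : S -> T) (a : T) :
  (\forall s \near F, A (u s)) -> u @ F --> a -> u @ F --> within A (nbhs a).
Proof.
move=> FA ua P /= /ua FP; apply: filterS2 FA FP => s As; exact.
Qed.

Lemma cvg_row (S : Type) (F : set_system S) (FF : Filter F)
    (u : S -> 'rV[R]_m) (a : 'rV[R]_m) :
  (forall j, u s 0 j @[s --> F] --> a 0 j) -> u @ F --> a.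
Proof.
move=> ua B [P aP PB].
have : \forall s \near F, forall j, P 0 j (u s 0 j).
  by apply: filter_forall => j; apply: ua; apply: aP.
by apply: filterS => s uP; apply: PB => /= i j; rewrite (ord1 i); apply: uP.
Qed.

Lemma set_coord_continuous x l : continuous (set_coord x l).
Proof.
move=> t; apply: cvg_row => j.
rewrite (_ : (fun s => set_coord x l s 0 j) =
  (fun s => if j == l then s else x 0 j)); last by apply/funext => s; rewrite mxE.
rewrite mxE; case: eqP => _; [exact: cvg_id | exact: cvg_cst].
Qed.

Lemma continuous_on_segment (T : topologicalType) (g : 'rV[R]_m -> T) l x (a b : R) :
  {within cube, continuous g} -> cube x -> 0 <= a -> b <= 1 ->
  {within `[a, b], continuous (fun t => g (set_coord x l t))}.
Proof.
move=> /subspace_continuousP gc cx a0 b1; apply/subspace_continuousP => t tab.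
have sub s : `[a, b]%classic s -> cube (set_coord x l s).
  rewrite /= in_itv /= => /andP[as_ sb]; apply: cube_set_coord => //.
  by rewrite (le_trans a0 as_) (le_trans sb b1).
apply: (cvg_comp (set_coord x l) g _ (gc _ (sub t tab))).
apply: cvg_to_within; last first.
  by apply: cvg_within_filter; apply: set_coord_continuous.
by near=> s; apply: sub; near: s; apply: withinT.
Unshelve. all: by end_near. Qed.

#[global] Instance pincrement_filter l x : Filter (pincrement l x).
Proof. by rewrite /pincrement; apply: within_filter. Qed.

(** One of the two faces in direction [l] is at distance at least [1 / 2], so arbitrarily small
    nonzero steps towards it stay in the cube. *)
Lemma pincrement_proper l x : cube x -> ProperFilter (pincrement l x).
Proof.
move=> cx; apply: Build_ProperFilter_ex => A.
rewrite /pincrement /within /= => /nbhs_ballP[e /= e0 eA].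
have /andP[x0 x1] := cx l.
pose r := Num.min (e / 2) (1 / 2); have r0 : 0 < r by rewrite lt_min; lra.
have re : r < e by rewrite gt_min; apply/orP; left; lra.
have r2 : r <= 1 / 2 by rewrite ge_min lexx orbT.
pose h := if x 0 l <= 1 / 2 then r else - r.
have hr : `|h| = r by rewrite /h; case: ifP => _; rewrite ?normrN gtr0_norm.
exists h; apply: eA => /=.
- by rewrite /ball /= sub0r normrN hr.
- by rewrite -normr_gt0 hr.
rewrite addr_delta; apply: cube_set_coord => //.
by rewrite /h; case: (leP (x 0 l)) => ?; lra.
Qed.

(** Away from the two faces in direction [l] all small steps are admissible, so a restricted
    derivative is an ordinary two-sided one. *)
Lemma pincrement_interior l x : cube x -> 0 < x 0 l < 1 ->
  0^' `=>` pincrement l x.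
Proof.
move=> cx /andP[x0 x1] A; rewrite /pincrement /within /= => FA.
near=> h; have : cube (x + h *: delta_mx 0 l).
  rewrite addr_delta; apply: cube_set_coord => //.
  have : `|h| < Num.min (x 0 l) (1 - x 0 l).
    near: h; apply: dnbhs0_lt; rewrite lt_min x0 subr_gt0//.
  by rewrite lt_min !ltr_norml; lra.
near: h; exact: FA.
Unshelve. all: by end_near. Qed.

Lemma is_derive_pquotient (g : 'rV[R]_m -> R) l x (t d : R) :
  cube x -> 0 < t < 1 ->
  pquotient g l (set_coord x l t) @ pincrement l (set_coord x l t) --> d ->
  is_derive t 1 (fun s => g (set_coord x l s)) d.
Proof.
move=> cx t01 gd.
have ct : cube (set_coord x l t).
  by apply: cube_set_coord => //; lra.
have {}gd : pquotient g l (set_coord x l t) @ 0^' --> d.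
  apply: cvg_trans gd; apply: cvg_app; apply: pincrement_interior => //.
  by rewrite set_coord_at.
have qE : pquotient g l (set_coord x l t) =
  (fun h => h^-1 *: (((fun s => g (set_coord x l s)) \o shift t) (h *: 1) -
     g (set_coord x l t))).
  apply/funext => h; rewrite /pquotient /=.
  by rewrite set_coordD [h *: 1]mulr1 [h + t]addrC.
rewrite qE in gd.
by apply: DeriveDef; [apply/cvg_ex; exists d | apply: cvg_lim].
Qed.

(** The classical theorem asks for derivatives only at inner points of the segment, where
    [is_derive_pquotient] supplies them. The order of [a] and [b] is free. *)
Lemma partial_MVT (g dg : 'rV[R]_m -> R) l :
  {within cube, continuous g} ->
  (forall y, cube y -> 0 < y 0 l < 1 ->
     pquotient g l y @ pincrement l y --> dg y) ->
  forall x (a b : R), cube x -> 0 <= a <= 1 -> 0 <= b <= 1 ->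
  exists c, [/\ 0 <= c <= 1, `|c - a| <= `|b - a| &
    g (set_coord x l b) - g (set_coord x l a) =
      dg (set_coord x l c) * (b - a)].
Proof.
move=> gc gd x.
have MVT01 (a b : R) : cube x -> 0 <= a -> a <= b -> b <= 1 ->
    exists2 c, a <= c <= b & g (set_coord x l b) - g (set_coord x l a) =
      dg (set_coord x l c) * (b - a).
  move=> cx a0 ab b1.
  have [s||c] := @MVT_segment R (fun t => g (set_coord x l t))
    (fun t => dg (set_coord x l t)) a b ab.
  - rewrite in_itv /= => /andP[as_ sb].
    have s01 : 0 < s < 1 by rewrite (le_lt_trans a0 as_) (lt_le_trans sb b1).
    apply: is_derive_pquotient => //; apply: gd; last by rewrite set_coord_at.
    by apply: cube_set_coord => //; lra.
  - exact: continuous_on_segment.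
  - by rewrite in_itv /= => cab E; exists c.
move=> a b cx /andP[a0 a1] /andP[b0 b1].
have [ab|ba] := leP a b.
  have [c cab E] := MVT01 a b cx a0 ab b1.
  by exists c; split=> //; [lra | rewrite !ger0_norm; lra].
have [c cab E] := MVT01 b a cx b0 (ltW ba) a1.
exists c; split; [lra | rewrite !ler0_norm; lra |].
by rewrite -opprB E -mulrN opprB.
Qed.

Section gradient_field.
Variables (g : 'rV[R]_m -> R) (dg : 'I_m -> 'rV[R]_m -> R).
Hypothesis g_cont : {within cube, continuous g}.
Hypothesis g_der : forall j y, cube y -> 0 < y 0 j < 1 ->
  pquotient g j y @ pincrement j y --> dg j y.

(** Each increment between successive hybrid points runs along one axis, where [partial_MVT]
    applies. The coordinatewise bounds make every [zeta j] tend to [p] when [q] does; this takes the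
    place of total differentiability. *)
Lemma increment_MVT p q : cube p -> cube q ->
  exists zeta : 'I_m -> 'rV[R]_m,
    [/\ forall j, cube (zeta j),
        forall j i, `|zeta j 0 i - p 0 i| <= `|q 0 i - p 0 i| &
        g q - g p = \sum_j dg j (zeta j) * (q 0 j - p 0 j)].
Proof.
move=> cp cq.
have /choice[zeta Z] : forall j, exists z, [/\ cube z,
    forall i, `|z 0 i - p 0 i| <= `|q 0 i - p 0 i| &
    g (set_coord (hybrid p q j) j (q 0 j)) - g (hybrid p q j) =
      dg j z * (q 0 j - p 0 j)].
  move=> j; have ch := cube_hybrid j cp cq.
  have [c [c01 cle E]] :=
    partial_MVT g_cont (@g_der j) ch (cp j) (cq j).
  exists (set_coord (hybrid p q j) j c); split.
  - exact: cube_set_coord.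
  - move=> i; rewrite !mxE; case: eqP => [->//|_].
    by case: ifP => // _; rewrite subrr normr0.
  - have := set_coord_id (hybrid p q j) j; rewrite hybrid_at => hE.
    by rewrite hE in E.
exists zeta; split=> [j|j|]; [by case: (Z j) | by case: (Z j) |].
by rewrite (hybrid_telescope g); apply: eq_bigr => j _; case: (Z j).
Qed.

Hypothesis dg_cont : forall j, {within cube, continuous (dg j)}.

(** By [increment_MVT] the quotient is a sum of quotients of the entries of [phi] times values of
    [dg j] at points tending to [phi y], where [dg j] is continuous on the cube. *)
Lemma pquotient_comp (phi : 'rV[R]_m -> 'rV[R]_m) l y :
  (forall x, cube x -> cube (phi x)) -> {within cube, continuous phi} ->
  cube y -> pderivable phi l y ->
  pquotient (g \o phi) l y @ pincrement l y -->
    \sum_j pderive phi l y 0 j * dg j (phi y).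
Proof.
move=> phi_cube /subspace_continuousP phi_cont cy phi_der.
pose q h := phi (y + h *: delta_mx 0 l).
have Fcube : \forall h \near pincrement l y, cube (y + h *: delta_mx 0 l).
  exact: withinT.
have q_cvg : q @ pincrement l y --> phi y.
  apply: (cvg_comp (fun h => y + h *: delta_mx 0 l) phi _ (phi_cont _ cy)).
  apply: cvg_to_within => //.
  have -> : (fun h => y + h *: delta_mx 0 l) = (fun h => set_coord y l (y 0 l + h)).
    by apply/funext => h; rewrite addr_delta.
  rewrite -[X in _ --> X](set_coord_id y l) -{2}[y 0 l]addr0.
  apply: (cvg_comp (fun h => y 0 l + h) (set_coord y l)); last first.
    exact: set_coord_continuous.
  apply: cvgD; first exact: cvg_cst.
  by apply: cvg_within_filter; apply: cvg_within_filter; apply: cvg_id.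
have /choice[zeta Z] : forall h, exists zeta : 'I_m -> 'rV[R]_m,
    cube (y + h *: delta_mx 0 l) ->
    [/\ forall j, cube (zeta j),
        forall j i, `|zeta j 0 i - phi y 0 i| <= `|q h 0 i - phi y 0 i| &
        g (q h) - g (phi y) = \sum_j dg j (zeta j) * (q h 0 j - phi y 0 j)].
  move=> h; have [ch|nch] := pselect (cube (y + h *: delta_mx 0 l)).
    by have [z zP] := increment_MVT (phi_cube _ cy) (phi_cube _ ch); exists z.
  (* An arbitrary value: the filter [pincrement l y] excludes such [h]. *)
  by exists (fun=> 0).
have zeta_cvg j : zeta h j @[h --> pincrement l y] --> phi y.
  apply: cvg_row => i; apply/cvgrPdist_lt => e e0.
  have /cvgrPdist_lt/(_ e e0) qe : q h 0 i @[h --> pincrement l y] --> phi y 0 i.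
    by apply: (cvg_comp q (fun v : 'rV[R]_m => v 0 i) q_cvg); apply: coord_continuous.
  near=> h; have ch : cube (y + h *: delta_mx 0 l) by near: h.
  have [_ zq _] := Z h ch.
  rewrite distrC; apply: le_lt_trans (zq j i) _; rewrite distrC.
  by near: h.
apply: (@cvg_trans _
  ((fun h => \sum_j pquotient phi l y h 0 j * dg j (zeta h j)) @ pincrement l y)).
  apply: near_eq_cvg; near=> h.
  have ch : cube (y + h *: delta_mx 0 l) by near: h.
  have [_ _ E] := Z h ch.
  rewrite /pquotient /= -/(q h) E scaler_sumr; apply: eq_bigr => j _.
  by rewrite !mxE -mulrA [_ * dg _ _]mulrC.
apply: cvg_sumr => j; apply: cvgM.
  by apply: (cvg_comp _ (fun v : 'rV[R]_m => v 0 j) phi_der); apply: coord_continuous.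
have /subspace_continuousP dgc := @dg_cont j.
apply: (cvg_comp (fun h => zeta h j) (dg j) _ (dgc _ (phi_cube _ cy))).
apply: cvg_to_within => //; near=> h.
have ch : cube (y + h *: delta_mx 0 l) by near: h.
by have [] := Z h ch.
Unshelve. all: by end_near. Qed.

End gradient_field.
End cube_calculus.

(** * Euclidean norm inequalities and functionals of norm at most one *)

Section euclidean_norm.
Variables (R : realType) (V : normedZmodType R) (k : nat).
Implicit Types (v w : 'rV[V]_k).

Lemma enorm_ge0 v : 0 <= enorm v.
Proof. exact: sqrtr_ge0. Qed.

Lemma enorm_le v (c : 'I_k -> R) : (forall i, `|v 0 i| <= c i) ->
  enorm v <= Num.sqrt (\sum_i c i ^+ 2).
Proof.
move=> vc; apply: ler_wsqrtr; apply: ler_sum => i _.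
by apply: lerXn2r => //; rewrite nnegrE// (le_trans _ (vc i)).
Qed.

Lemma coord_le_enorm v i : `|v 0 i| <= enorm v.
Proof.
rewrite -[leLHS]normr_id -sqrtr_sqr; apply: ler_wsqrtr.
by rewrite (bigD1 i)//= lerDl sumr_ge0// => j _; rewrite sqr_ge0.
Qed.

Lemma enorm0 : enorm (0 : 'rV[V]_k) = 0.
Proof.
by rewrite /enorm big1 ?sqrtr0// => i _; rewrite mxE normr0 expr0n.
Qed.

End euclidean_norm.

Lemma enormZ (R : realType) (k : nat) (a : R) (v : 'rV[R]_k) :
  enorm (a *: v) = `|a| * enorm v.
Proof.
rewrite /enorm -[in RHS](normr_id a) -sqrtr_sqr -sqrtrM ?sqr_ge0// mulr_sumr.
by congr Num.sqrt; apply: eq_bigr => i _; rewrite mxE normrM exprMn.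
Qed.

Lemma cvg_enorm (R : realType) (k : nat) (S : Type) (F : set_system S)
    (FF : Filter F) (u : S -> 'rV[R]_k) (v : 'rV[R]_k) :
  u @ F --> v -> enorm (u s) @[s --> F] --> enorm v.
Proof.
move=> uv.
have S_cvg : \sum_i `|u s 0 i| ^+ 2 @[s --> F] --> \sum_i `|v 0 i| ^+ 2.
  apply: cvg_sumr => i.
  have N_cvg : `|u s 0 i| @[s --> F] --> `|v 0 i|.
    apply: cvg_norm; apply: (cvg_comp u (fun w : 'rV[R]_k => w 0 i) uv).
    exact: coord_continuous.
  apply: (cvg_comp _ (fun r : R => r ^+ 2) N_cvg); exact: exprn_continuous.
apply: (cvg_comp _ Num.sqrt S_cvg); exact: sqrt_continuous.
Qed.

(** Lagrange's identity: the double sum of the squares [(a i * b j - a j * b i) ^+ 2] equals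
    [2 * (A * B - C ^+ 2)]. *)
Lemma cauchy_schwarz (R : realType) (k : nat) (a b : 'I_k -> R) :
  \sum_i a i * b i <= Num.sqrt (\sum_i a i ^+ 2) * Num.sqrt (\sum_i b i ^+ 2).
Proof.
set A := \sum_i a i ^+ 2; set B := \sum_i b i ^+ 2; set C := \sum_i a i * b i.
have A0 : 0 <= A by apply: sumr_ge0 => i _; apply: sqr_ge0.
have B0 : 0 <= B by apply: sumr_ge0 => i _; apply: sqr_ge0.
have CAB : C ^+ 2 <= A * B.
  have : 0 <= \sum_i \sum_j (a i * b j - a j * b i) ^+ 2.
    by apply: sumr_ge0 => i _; apply: sumr_ge0 => j _; apply: sqr_ge0.
  have -> : \sum_i \sum_j (a i * b j - a j * b i) ^+ 2 =
      \sum_i (a i ^+ 2 * B + b i ^+ 2 * A - 2 * (a i * b i) * C).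
    apply: eq_bigr => i _; rewrite !mulr_sumr -big_split -sumrB /=.
    by apply: eq_bigr => j _; ring.
  rewrite sumrB big_split /= -!mulr_suml -mulr_sumr -/A -/B -/C; nra.
rewrite -sqrtrM//; apply: le_trans (ler_norm _) _.
by rewrite -sqrtr_sqr; apply: ler_wsqrtr.
Qed.

Lemma enorm_pairing (R : realType) (V : normedModType R) (k : nat)
    (lam : {scalar V}) (a : 'rV[R]_k) (w : 'rV[V]_k) :
  (forall v, `|lam v| <= `|v|) ->
  `|\sum_j a 0 j * lam (w 0 j)| <= enorm a * enorm w.
Proof.
move=> lam_le; apply: le_trans (ler_norm_sum _ _ _) _.
apply: le_trans (cauchy_schwarz (fun i => `|a 0 i|) (fun i => `|w 0 i|)).
by apply: ler_sum => j _; rewrite normrM ler_wpM2l.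
Qed.

Lemma cvg_functional (R : realType) (V : normedModType R) (lam : {scalar V})
    (S : Type) (F : set_system S) (FF : Filter F) (u : S -> V) (v : V) :
  (forall v, `|lam v| <= `|v|) ->
  u @ F --> v -> lam (u s) @[s --> F] --> lam v.
Proof.
move=> lam_le /cvgrPdist_lt uv; apply/cvgrPdist_lt => e e0.
near=> s; rewrite -linearB; apply: le_lt_trans (lam_le _) _.
by near: s; apply: uv.
Unshelve. all: by end_near. Qed.

(** * Consequences of compactness and of the Lipschitz conditions on the cube *)

Section cube_maps.
Variables (R : realType) (m : nat).

Lemma cube_compact : compact (@cube R m).
Proof.
rewrite (_ : cube = [set v : 'rV[R]_m | forall i, `[0, 1]%classic (v 0 i)]).
  by apply: (@rV_compact R m (fun=> `[0, 1]%classic)) => _; apply: segment_compact.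
by apply/seteqP; split => x /= cx i; have := cx i; rewrite /= in_itv.
Qed.

Lemma cube0 : cube (0 : 'rV[R]_m).
Proof. by move=> l; rewrite mxE lexx ler01. Qed.

Lemma lipschitz_cube_continuous (phi : 'rV[R]_m -> 'rV[R]_m) :
  lipschitz_cube phi -> {within cube, continuous phi}.
Proof.
move=> [K phiK]; apply/subspace_continuousP => x cx; apply: cvg_row => i.
apply/cvgrPdist_lt => e e0.
have xx : x - y @[y --> within cube (nbhs x)] --> (0 : 'rV[R]_m).
  by rewrite -(subrr x); apply: cvgB; [exact: cvg_cst | exact: cvg_within].
have Kx : K * enorm (x - y) @[y --> within cube (nbhs x)] --> (0 : R).
  rewrite -[X in _ --> X](mulr0 K) -(@enorm0 R R m).
  by apply: cvgM; [exact: cvg_cst | exact: cvg_enorm xx].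
near=> y; have cy : cube y by near: y; apply: withinT.
have -> : phi x 0 i - phi y 0 i = (phi x - phi y) 0 i by rewrite !mxE.
apply: le_lt_trans (coord_le_enorm _ _) _.
apply: le_lt_trans (phiK x y cx cy) _.
by near: y; apply: (cvgr_lt _ Kx).
Unshelve. all: by end_near. Qed.

Lemma enorm_pderive_le (phi : 'rV[R]_m -> 'rV[R]_m) l L x :
  partial_lipschitz phi l L -> cube x -> pderivable phi l x ->
  enorm (pderive phi l x) <= L.
Proof.
move=> [L0 phiL] cx phi_der.
have FP := pincrement_proper l cx.
have enorm_cvg : enorm (pquotient phi l x h) @[h --> pincrement l x] -->
    enorm (pderive phi l x).
  exact: cvg_enorm phi_der.
apply: (cvgr_to_le enorm_cvg); near=> h.
have ch : cube (x + h *: delta_mx 0 l) by near: h; apply: withinT.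
have h0 : h != 0.
  near: h; apply: (@cvg_within R (0 : R)^').
  exact: (@nbhs_dnbhs_neq R 0).
rewrite /pquotient enormZ normfV ler_pdivrMl ?normr_gt0// mulrC.
apply: le_trans (phiL _ _ ch cx _) _.
  by move=> j jl; rewrite addr_delta mxE (negbTE jl).
by rewrite addr_delta set_coord_at [x 0 l + h]addrC addrK.
Unshelve. all: by end_near. Qed.

Lemma pderive_bounded (V : normedModType R) (f : 'rV[R]_m -> V) l :
  {within cube, continuous (pderive f l)} ->
  exists M, forall x, cube x -> `|pderive f l x| <= M.
Proof.
move=> fc; have := compact_bounded (continuous_compact fc cube_compact).
move=> [M [_ MP]]; exists (M + 1) => x cx; apply: (MP (M + 1)); first by rewrite ltrDl.
by exists x.
Qed.

End cube_maps.

(** * Norming functionals on the complex plane *)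

(** The real part of [w] times the conjugate of [z], over the modulus of [z]; for [z = 0] division
    by zero makes it the zero functional. *)
Definition norming (R : realType) (z w : Rcomplex R) : R :=
  (complex.Re z * complex.Re w + complex.Im z * complex.Im w) / `|z|.

Lemma norming_is_scalar (R : realType) (z : Rcomplex R) : scalar (norming z).
Proof.
by move=> a u v; rewrite /norming !linearP /=; ring.
Qed.

HB.instance Definition _ (R : realType) (z : Rcomplex R) :=
  GRing.isLinear.Build R (Rcomplex R) R _ (norming z) (norming_is_scalar z).

Lemma Rcomplex_normE (R : realType) (z : Rcomplex R) :
  `|z| = Num.sqrt (complex.Re z ^+ 2 + complex.Im z ^+ 2).
Proof. by case: z. Qed.

Lemma norming_self (R : realType) (z : Rcomplex R) : norming z z = `|z|.
Proof.
have [->|z0] := eqVneq z 0; first by rewrite linear0 normr0.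
rewrite /norming -!expr2; apply: (canLR (mulfK _)); first by rewrite normr_eq0.
by rewrite -expr2 Rcomplex_normE sqr_sqrtr// addr_ge0 ?sqr_ge0.
Qed.

Lemma norming_le (R : realType) (z w : Rcomplex R) : `|norming z w| <= `|w|.
Proof.
have [->|z0] := eqVneq z 0.
  by rewrite /norming /= !mul0r add0r mul0r normr0.
rewrite /norming normrM normfV normr_id ler_pdivrMr ?normr_gt0// mulrC.
rewrite !Rcomplex_normE -sqrtrM ?addr_ge0 ?sqr_ge0// -sqrtr_sqr.
apply: ler_wsqrtr.
(* This square is the gap in the two-dimensional Cauchy-Schwarz inequality. *)
have := sqr_ge0 (complex.Re z * complex.Im w - complex.Im z * complex.Re w).
nra.
Qed.

(** * The Bernstein error of [f \o phi] seen through one functional *)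

Section koopman_error.
Variables (R : realType) (m : nat) (V : normedModType R).
Variables (phi : 'rV[R]_m -> 'rV[R]_m) (Lphi Ldphi : 'I_m -> R).
Hypothesis phi_cube : phi @` cube `<=` cube.
Hypothesis phi_cont : {within cube, continuous phi}.
Hypothesis phi_plip : forall l, partial_lipschitz phi l (Lphi l).
Hypothesis phi_der : forall l x, cube x -> pderivable phi l x.
Hypothesis dphi_plip :
  forall l, partial_lipschitz (pderive phi l) l (Ldphi l).
Variable f : 'rV[R]_m -> V.
Hypothesis f_C1 : C1_cube f.

Let omega := modulus_on (phi @` cube) (gradient f).
Let sup_grad := sup [set enorm (gradient f x) | x in phi @` cube].

Let cube_phi x : cube x -> cube (phi x).
Proof. by move=> cx; apply: phi_cube; exists x. Qed.

(** This makes the sets under [omega] and [sup_grad] bounded above, so that each [sup] dominates its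
    elements. *)
Lemma gradient_bounded :
  exists M, forall x i, cube x -> `|gradient f x 0 i| <= M i.
Proof.
have [_ f_der] := f_C1.
have /choice[M MP] : forall i, exists M, forall x, cube x -> `|pderive f i x| <= M.
  by move=> i; apply: pderive_bounded; case: (f_der i).
by exists M => x i cx; rewrite mxE; apply: MP.
Qed.

Lemma enorm_gradient_le x : cube x -> enorm (gradient f (phi x)) <= sup_grad.
Proof.
move=> cx; have [M MP] := gradient_bounded.
apply: ub_le_sup; last by exists (phi x) => //; exists x.
exists (Num.sqrt (\sum_i M i ^+ 2)) => _ [_ [y cy <-] <-].
by apply: enorm_le => i; apply: MP; apply: cube_phi.
Qed.

Lemma gradient_modulus_le x y d : cube x -> cube y ->
  enorm (phi x - phi y) <= d ->
  enorm (gradient f (phi x) - gradient f (phi y)) <= omega d.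
Proof.
move=> cx cy xyd; have [M MP] := gradient_bounded.
apply: ub_le_sup; last first.
  by exists (phi x), (phi y); split=> //; apply: imageP.
exists (Num.sqrt (\sum_i (M i + M i) ^+ 2)) => _ [_ [_ [[z cz <-] [t ct <-] _ ->]]].
apply: enorm_le => i; rewrite !mxE; apply: le_trans (ler_normB _ _) _.
have Mphi u : cube u -> `|pderive f i (phi u)| <= M i.
  by move=> cu; have := MP _ i (cube_phi cu); rewrite mxE.
by apply: lerD; apply: Mphi.
Qed.

Variable lam : {scalar V}.
Hypothesis lam_le : forall v, `|lam v| <= `|v|.

(* The chain-rule expression of the [l]-th partial derivative of
   [lam \o f \o phi]. *)
Let D l y := \sum_j pderive phi l y 0 j * lam (pderive f j (phi y)).

Let g := lam \o f \o phi.

Lemma functional_within (u : 'rV[R]_m -> V) :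
  {within cube, continuous u} -> {within cube, continuous (lam \o u)}.
Proof.
move=> /subspace_continuousP uc; apply/subspace_continuousP => x cx.
exact: cvg_functional (uc x cx).
Qed.

Lemma pquotient_functional j y : cube y ->
  pquotient (lam \o f) j y @ pincrement j y --> lam (pderive f j y).
Proof.
move=> cy; have [_ /(_ j) [/(_ y cy) f_der _]] := f_C1.
have -> : pquotient (lam \o f) j y = (fun h => lam (pquotient f j y h)).
  by apply/funext => h; rewrite /pquotient [in RHS]linearZ [in RHS]linearB.
exact: cvg_functional f_der.
Qed.

Lemma g_continuous : {within cube, continuous g}.
Proof.
have [/subspace_continuousP fc _] := f_C1.
have /subspace_continuousP pc := phi_cont.
apply/subspace_continuousP => x cx; apply: cvg_functional => //.
apply: (cvg_comp phi f _ (fc _ (cube_phi cx))).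
have pcx : phi @ within cube (nbhs x) --> phi x by exact: pc.
have phi_near : \forall y \near within cube (nbhs x), cube (phi y).
  by near=> y; apply: cube_phi; near: y; apply: withinT.
exact: (cvg_to_within _ phi_near pcx).
Unshelve. all: by end_near. Qed.

Lemma g_derivative l y : cube y ->
  pquotient g l y @ pincrement l y --> D l y.
Proof.
move=> cy; have [fc f_der] := f_C1.
apply: (@pquotient_comp R m (lam \o f) (fun j => lam \o pderive f j)) => //.
- exact: functional_within.
- by move=> j z cz _; apply: pquotient_functional.
- by move=> j; apply: functional_within; case: (f_der j).
- exact: phi_der.
Qed.

(** The difference of products is split into the change of the gradient paired with
    [pderive phi l ya], and the change of [pderive phi l] paired with the gradient at [phi yb]; each
    gives one summand of the bound. *)
Lemma derivative_modulus l y (a b d : R) :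
  cube y -> 0 <= a <= 1 -> 0 <= b <= 1 -> `|a - b| <= d ->
  `|D l (set_coord y l a) - D l (set_coord y l b)| <=
    Lphi l * omega (Lphi l * d) + sup_grad * (Ldphi l * d).
Proof.
move=> cy a01 b01 abd.
set ya := set_coord y l a; set yb := set_coord y l b.
have ca : cube ya by apply: cube_set_coord.
have cb : cube yb by apply: cube_set_coord.
have off j : j != l -> ya 0 j = yb 0 j by move=> jl; rewrite !mxE (negbTE jl).
have [L0 phiL] := phi_plip l; have [Ld0 dphiL] := dphi_plip l.
have -> : D l ya - D l yb =
    \sum_j pderive phi l ya 0 j *
      lam ((gradient f (phi ya) - gradient f (phi yb)) 0 j) +
    \sum_j (pderive phi l ya - pderive phi l yb) 0 j *
      lam (gradient f (phi yb) 0 j).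
  rewrite -sumrB -big_split /=; apply: eq_bigr => j _.
  by rewrite !mxE linearB /=; ring.
apply: le_trans (ler_normD _ _) _; apply: lerD.
  apply: le_trans (enorm_pairing _ _ lam_le) _.
  apply: ler_pM; rewrite ?enorm_ge0//.
    by apply: enorm_pderive_le => //; apply: phi_der.
  apply: gradient_modulus_le => //; apply: le_trans (phiL _ _ ca cb off) _.
  by rewrite !set_coord_at ler_wpM2l.
apply: le_trans (enorm_pairing _ _ lam_le) _; rewrite mulrC.
apply: ler_pM; rewrite ?enorm_ge0//; first exact: enorm_gradient_le.
by apply: le_trans (dphiL _ _ ca cb off) _; rewrite !set_coord_at ler_wpM2l.
Qed.

Lemma functional_error (n : 'I_m -> nat) x : (forall l, (0 < n l)%N) -> cube x ->
  `|\sum_(k : {dffun forall l : 'I_m, 'I_(n l).+1})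
      (\prod_l bernstein_basis (n l) (k l) (x 0 l)) *
        (g (bernstein_node R k) - g x)| <=
  \sum_l (Num.sqrt (n l)%:R)^-1 *
    (Lphi l * omega (Lphi l / (2 * Num.sqrt (n l)%:R))
     + sup_grad * (Ldphi l / (2 * Num.sqrt (n l)%:R))).
Proof.
move=> n_gt0 cx; apply: bernstein_error_coord => // l y cy.
set delta := (2 * Num.sqrt (n l)%:R)^-1.
set W := Lphi l * _ + _.
have d0 : 0 < delta by rewrite invr_gt0 mulr_gt0// sqrtr_gt0 ltr0n.
have DW a b : 0 <= a <= 1 -> 0 <= b <= 1 -> `|a - b| <= delta ->
    `|D l (set_coord y l a) - D l (set_coord y l b)| <= W.
  exact: derivative_modulus.
(* The sign of [W] is read off from its role as a bound, at two equal points. *)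
have W0 : 0 <= W.
  by apply: le_trans (DW 0 0 _ _ _); rewrite ?subrr ?normr0 ?lexx ?ler01 ?ltW.
under eq_bigr do rewrite -[X in _ - g X](set_coord_id y l).
apply: (@bernstein_error_1d _ _ _ (fun t => g (set_coord y l t)) (D l y)) => //.
move=> t t01.
have [c [c01 ct ->]] := partial_MVT g_continuous
  (fun z cz _ => g_derivative (l := l) cz) cy (cy l) t01.
rewrite -mulrBl normrM mulrC; apply: ler_wpM2l => //.
(* [c] is no farther from [y 0 l] than [t] is, so the chaining bound at [c] implies the one required
   at [t]. *)
rewrite -[in D l y](set_coord_id y l).
apply: le_trans (modulus_chain d0 W0 DW c01 (cy l)) _.
rewrite -/delta; apply: ler_wpM2r => //; rewrite lerD2l; apply: ler_wpM2r => //.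
by rewrite invr_ge0; apply: ltW.
Qed.

End koopman_error.

Theorem theorem4p5 (R : realType) (m : nat) (hm : (0 < m)%N)
  (phi : 'rV[R]_m -> 'rV[R]_m) (Lphi Ldphi : 'I_m -> R)
  (phi_cube : phi @` cube `<=` cube)
  (phi_lip : lipschitz_cube phi)
  (phi_plip : forall l, partial_lipschitz phi l (Lphi l))
  (phi_der : forall l x, cube x -> pderivable phi l x)
  (dphi_lip : forall l, lipschitz_cube (pderive phi l))
  (dphi_plip : forall l, partial_lipschitz (pderive phi l) l (Ldphi l))
  (f : 'rV[R]_m -> Rcomplex R) (f_C1 : C1_cube f)
  (n : 'I_m -> nat) (n_gt0 : forall l, (0 < n l)%N) :
  supnorm (bernstein n (koopman phi f) \- koopman phi f) <=
  \sum_(l < m) (Num.sqrt (n l)%:R)^-1 *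
    (Lphi l * modulus_on (phi @` cube) (gradient f)
                (Lphi l / (2 * Num.sqrt (n l)%:R))
     + sup [set enorm (gradient f x) | x in phi @` cube]
       * (Ldphi l / (2 * Num.sqrt (n l)%:R))).
Proof.
apply: ge_sup.
  exists `|(bernstein n (koopman phi f) \- koopman phi f) 0|, 0 => //.
  exact: cube0.
move=> _ [x cx <-].
pose z := bernstein n (koopman phi f) x - koopman phi f x.
rewrite [X in X <= _](_ : _ = `|norming z z|); last first.
  by rewrite norming_self normr_id.
apply: le_trans (functional_error phi_cube (lipschitz_cube_continuous phi_lip)
  phi_plip phi_der dphi_plip f_C1 (@norming_le R z) n_gt0 cx).
rewrite le_eqVlt; apply/orP; left; apply/eqP; congr `| _ |.
(* Since the weights sum to one and [norming z] is linear, the averaged differences add up to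
   [norming z z]. *)
rewrite [in RHS](eq_bigr _ (fun k _ => mulrBr _ _ _)) sumrB.
rewrite -mulr_suml bernstein_weights_sum mul1r {2}/z linearB /bernstein.
rewrite linear_sum; congr (_ - _).
by apply: eq_bigr => k _; rewrite linearZ.
Qed.
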